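(* Let $G$ be a connected unicyclic graph that is not König–Egerváry. Consider any sequence of steps of the procedure below that produces $G$, and let $B$ be the set of black vertices of the resulting coloring. Then $B$ is a critical set of $G$. Procedure: (1) Construct an odd cycle and color its vertices blue. (2) Either perform step (3), or perform step (4), or stop. (3) Choose any existing vertex $u$, add two new vertices $u_1,u_2$ and edges $uu_1, u_1u_2$; color $u_1$ red and $u_2$ black; go to (2). (4) If there is a red vertex, choose a red vertex $u$, add a new vertex $u_1$ and the edge $uu_1$, color $u_1$ black; go to (2).
   Context: All graphs are finite and simple. $\alpha(G)$, $\mu(G)$ are independence and matching numbers; $G$ is König–Egerváry if $\alpha(G)+\mu(G)=|V(G)|$; unicyclic means having exactly one cycle. For $A\subseteq V(G)$, $N(A)$ is the set of vertices adjacent to some vertex of $A$, $d(A)=|A|-|N(A)|$, $d_c(G)=\max\{d(A):A\subseteq V(G)\}$, and $A$ is critical if $d(A)=d_c(G)$. Every connected unicyclic non-König–Egerváry graph is (isomorphic to a graph) produced by the procedure. *)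

(* Defs.v *)
From HB Require Import structures.
From mathcomp Require Import all_boot all_order all_algebra.
Set Implicit Arguments.
Unset Strict Implicit.
Unset Printing Implicit Defensive.
Import Order.TTheory GRing.Theory Num.Theory.

(* A finite simple graph is a symmetric irreflexive relation [e : rel T] on a
   finite type [T] of vertices; edges are the corresponding two-element sets. *)
Section Graphs.
Variables (T : finType) (e : rel T).

Definition edges : {set {set T}} :=
  [set [set p.1; p.2] | p : T * T & e p.1 p.2].

Definition independent (A : {set T}) : bool :=
  [forall x in A, forall y in A, ~~ e x y].

Definition matching (M : {set {set T}}) : bool :=
  (M \subset edges) && trivIset M.

Definition alpha : nat := \max_(A : {set T} | independent A) #|A|.

Definition mu : nat := \max_(M : {set {set T}} | matching M) #|M|.

Definition konig_egervary : bool := (alpha + mu == #|T|)%N.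

Definition connected : Prop := forall x y : T, connect e x y.

End Graphs.

Definition cyclic_edges (T : finType) (s : seq T) : {set {set T}} :=
  [set [set x; next s x] | x in s].

(* A cycle is identified with its edge set, so that the choice of a starting
   vertex and of a direction does not matter. *)
Definition is_cycle (T : finType) (e : rel T) (C : {set {set T}}) : Prop :=
  exists s : seq T,
    [/\ (3 <= size s)%N, uniq s, path.cycle e s & C = cyclic_edges s].

Definition unicyclic (T : finType) (e : rel T) : Prop :=
  exists! C : {set {set T}}, is_cycle e C.

Section Critical.
Variables (T : finType) (e : rel T).
Local Open Scope ring_scope.

Definition neighborhood (A : {set T}) : {set T} :=
  [set v | [exists u in A, e u v]].

Definition difference (A : {set T}) : int :=
  #|A|%:Z - #|neighborhood A|%:Z.

Definition critical_difference : int :=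
  \big[Num.max/difference set0]_(A : {set T}) difference A.

Definition critical (A : {set T}) : bool :=
  difference A == critical_difference.

End Critical.

(* A colored graph whose vertices are drawn from [T]: the existing vertices are
   those having a color, and the elements of [T] without a color are available
   as new vertices. *)
Record colored_graph (T : finType) := ColoredGraph {
  blue : {set T};
  red : {set T};
  black : {set T};
  edge_set : {set {set T}}
}.

Definition vertices (T : finType) (H : colored_graph T) : {set T} :=
  blue H :|: red H :|: black H.

Inductive procedure (T : finType) : colored_graph T -> Prop :=
| OddCycle (s : seq T) :
    (3 <= size s)%N -> odd (size s) -> uniq s ->
    procedure (ColoredGraph [set x in s] set0 set0 (cyclic_edges s))
| AddRedBlack (H : colored_graph T) (u u1 u2 : T) :
    procedure H -> u \in vertices H ->
    u1 \notin vertices H -> u2 \notin vertices H -> u1 != u2 ->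
    procedure (ColoredGraph (blue H) (u1 |: red H) (u2 |: black H)
                 (edge_set H :|: [set [set u; u1]; [set u1; u2]]))
| AddBlack (H : colored_graph T) (u u1 : T) :
    procedure H -> u \in red H -> u1 \notin vertices H ->
    procedure (ColoredGraph (blue H) (red H) (u1 |: black H)
                 ([set u; u1] |: edge_set H)).

Definition produces (T : finType) (H : colored_graph T) (e : rel T) : Prop :=
  [/\ procedure H, vertices H = [set: T] & edge_set H = edges e].

(* Main.v *)
Require Import Defs.
From HB Require Import structures.
From mathcomp Require Import all_boot all_order all_algebra.
Set Implicit Arguments.
Unset Strict Implicit.
Unset Printing Implicit Defensive.

(** Every neighbor of a black vertex is red, so [d(B) >= |B| - |R|]. Conversely,
    moving along the odd cycle on blue vertices and swapping the red and black
    vertices created together by a step (3) is an injection of all vertices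
    except those created by a step (4), sending each vertex to a neighbor.
    Hence [d(A)] is at most the number of steps (4), which is [|B| - |R|],
    for every [A]. *)

Lemma set2_inj (T : finType) (x y u v : T) :
  [set x; y] = [set u; v] -> (x = u /\ y = v) \/ (x = v /\ y = u).
Proof.
move=> E.
have := set21 x y; have := set22 x y; rewrite E !inE.
have := set21 u v; have := set22 u v; rewrite -E !inE.
by move=> /orP[]/eqP-> /orP[]/eqP-> /orP[]/eqP ? /orP[]/eqP ?; subst; auto.
Qed.

Lemma edgesE (T : finType) (e : rel T) (x y : T) :
  symmetric e -> ([set x; y] \in edges e) = e x y.
Proof.
move=> e_sym; apply/imsetP/idP => [[[u v] /=]|exy]; last by exists (x, y); rewrite ?inE.
by rewrite inE /= => euv /set2_inj [] [-> ->] //; rewrite e_sym.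
Qed.

(** The map [f] embeds [A :\: D] into the neighborhood of [A], and [A :&: D] has at most [#|D|]
    elements. *)
Lemma difference_le_defect (T : finType) (e : rel T) (D : {set T}) (f : T -> T)
    (A : {set T}) :
  {in ~: D &, injective f} -> {in ~: D, forall x, e x (f x)} ->
  (difference e A <= #|D|%:Z)%R.
Proof.
move=> f_inj f_edge; rewrite /difference Num.Theory.lerBlDr -PoszD lez_nat.
rewrite -(cardsID D A); apply: leq_add; first exact/subset_leq_card/subsetIr.
rewrite -(card_in_imset (f := f)) => [|x y]; last first.
  by rewrite !inE => /andP[xD _] /andP[yD _]; apply: f_inj; rewrite inE.
apply/subset_leq_card/subsetP => _ /imsetP[x /setDP[xA xD] ->].
by rewrite inE; apply/existsP; exists x; rewrite xA f_edge // inE.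
Qed.

Section Procedure.
Variable T : finType.
Implicit Types (H : colored_graph T) (x y : T).

(** This makes freshness usable: no earlier edge touches a vertex about to be added. *)
Lemma procedure_edge_vertices H x y :
  procedure H -> [set x; y] \in edge_set H ->
  (x \in vertices H) && (y \in vertices H).
Proof.
rewrite /vertices => P; elim: P x y => {H}
  [s _ _ _|H u u1 u2 _ IH uV _ _ _|H u u1 _ IH uR _] x y /=.
- by case/imsetP=> z zs /set2_inj [] [-> ->]; rewrite !inE ?mem_next zs.
- move: uV; rewrite !inE => /orP uV.
  case/or3P=> [/IH|/eqP/set2_inj|/eqP/set2_inj].
  + by rewrite !inE => /andP[/orP[/orP[]|] -> /orP[/orP[]|] ->];
      rewrite ?orbT.
  + by case=> [] [-> ->]; rewrite !eqxx ?orbT /=;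
      case: uV => [/orP[]|] ->; rewrite ?orbT.
  + by case=> [] [-> ->]; rewrite !eqxx ?orbT.
- rewrite !inE; case/orP=> [/eqP/set2_inj|/IH].
  + by case=> [] [-> ->]; rewrite uR eqxx ?orbT.
  + by rewrite !inE => /andP[/orP[/orP[]|] -> /orP[/orP[]|] ->];
      rewrite ?orbT.
Qed.

(** This rules out that the red vertex chosen in a step (4), which gains a black neighbor, is itself
    black. *)
Lemma procedure_red_black H : procedure H -> [disjoint red H & black H].
Proof.
elim=> {H} [s _ _ _|H u u1 u2 _ IH _ u1V u2V u12|H u u1 _ IH _ u1V] /=.
- by rewrite -setI_eq0 set0I.
- apply/pred0P => x; rewrite /= !inE.
  have := disjointFr IH (x := x); move: u1V u2V; rewrite !inE !negb_or.
  case: eqVneq => [->|_] /= /andP[_ /negPf B1]; first by rewrite B1 (negPf u12).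
  case: eqVneq => [->|_] /= /andP[/andP[_ /negPf R2] _]; first by rewrite R2.
  by case: (x \in red H) => // ->.
- apply/pred0P => x; rewrite /= !inE.
  have := disjointFr IH (x := x); move: u1V; rewrite !inE !negb_or.
  case: eqVneq => [->|_] /= /andP[/andP[_ /negPf R1] _]; first by rewrite R1.
  by case: (x \in red H) => // ->.
Qed.

(** A black vertex is attached to a red one when created; later it can gain neighbors only as the
    [u] of a step (3), and then the new neighbor [u1] is red. *)
Lemma procedure_black_neighbor_red H x y :
  procedure H -> x \in black H -> [set x; y] \in edge_set H -> y \in red H.
Proof.
move=> P; elim: P x y => {H}
  [s _ _ _|H u u1 u2 P IH uV u1V u2V u12|H u u1 P IH uR u1V] x y /=.
- by rewrite inE.
- have u1B : u1 \notin black H by apply: contra u1V; rewrite !inE => ->; rewrite orbT.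
  have uu2 : u != u2 by apply: contraNneq u2V => <-.
  (* An old edge cannot contain the fresh [u2]. Both new edges contain [u1], which is not black, so
     a black [x] on one of them forces [y = u1]. *)
  rewrite !inE => xB /or3P[xy|/eqP/set2_inj|/eqP/set2_inj].
  + case/predU1P: xB => [x2|xB]; last by rewrite (IH x y) ?orbT.
    by have /andP[] := procedure_edge_vertices P xy; rewrite x2 (negPf u2V).
  + by case=> [] [xE ->]; rewrite ?eqxx //;
      move: xB; rewrite xE (negPf u12) (negPf u1B).
  + by case=> [] [xE ->]; rewrite ?eqxx //;
      move: xB; rewrite xE (negPf u12) (negPf u1B).
- rewrite !inE => xB /orP[/eqP/set2_inj|xy].
  + case=> [] [xE ->] //; move: xB; rewrite xE => /predU1P[uu1|].
      by move: u1V; rewrite !inE -uu1 uR orbT.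
    by rewrite (disjointFr (procedure_red_black P) uR).
  + case/predU1P: xB => [x1|xB]; last exact: IH xB xy.
    by have /andP[] := procedure_edge_vertices P xy; rewrite x1 (negPf u1V).
Qed.

(* [D] is the set of vertices created by the steps (4). *)
Lemma procedure_defect H : procedure H ->
  exists (D : {set T}) (f : T -> T),
    [/\ #|D| + #|red H| <= #|black H|,
        {in vertices H :\: D &, injective f} &
        {in vertices H :\: D, forall x, [set x; f x] \in edge_set H}].
Proof.
move=> P; elim: P => {H} [s _ _ Us|H u u1 u2 P [D [f [cD f_inj f_edge]]]
  uV u1V u2V u12|H u u1 P [D [f [cD f_inj f_edge]]] uR u1V].
(* No step (4) has occurred yet, and [next s] is a rotation of the cycle, with inverse [prev s]. *)
- exists set0, (next s); split=> /=; first by rewrite !cards0.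
    by move=> x y _ _; apply: can_inj (prev_next Us) x y.
  by move=> x; rewrite /vertices /= !inE !orbF => xs; apply: imset_f.
(* The new map swaps [u1] and [u2] along their edge and agrees with [f] elsewhere. Since [f] takes
   values among the old vertices, the two images cannot collide. *)
- pose g x := if x == u1 then u2 else if x == u2 then u1 else f x.
  have u1R : u1 \notin red H.
    by apply: contra u1V; rewrite !inE => ->; rewrite orbT.
  have u2B : u2 \notin black H.
    by apply: contra u2V; rewrite !inE => ->; rewrite orbT.
  have fV x : x \in vertices H :\: D -> f x \in vertices H.
    by move=> /f_edge/(procedure_edge_vertices P)/andP[].
  have f1 x : x \in vertices H :\: D -> f x != u1.
    by move=> /fV fxV; apply: contraNneq u1V => <-.
  have f2 x : x \in vertices H :\: D -> f x != u2.
    by move=> /fV fxV; apply: contraNneq u2V => <-.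
  set H' := ColoredGraph _ _ _ _.
  have V' x : x \in vertices H' :\: D ->
      [\/ x = u1, x = u2 | [/\ x != u1, x != u2 & x \in vertices H :\: D]].
    case: (eqVneq x u1) => [|x1]; first by constructor 1.
    case: (eqVneq x u2) => [|x2]; first by constructor 2.
    rewrite /vertices !inE (negPf x1) (negPf x2) /= => xV.
    by constructor 3.
  have g1 : g u1 = u2 by rewrite /g eqxx.
  have g2 : g u2 = u1 by rewrite /g eqxx eq_sym (negPf u12).
  have gf x : x != u1 -> x != u2 -> g x = f x.
    by rewrite /g => /negPf-> /negPf->.
  exists D, g; split=> /=; first by rewrite !cardsU1 u1R u2B addnCA leq_add2l.
  + move=> x y /V'[->|->|[x1 x2 xV]] /V'[->|->|[y1 y2 yV]];
      rewrite ?g1 ?g2 ?gf //.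
    * by move=> fy; have := f2 y yV; rewrite -fy eqxx.
    * by move=> fy; have := f1 y yV; rewrite -fy eqxx.
    * by move=> fx; have := f2 x xV; rewrite fx eqxx.
    * by move=> fx; have := f1 x xV; rewrite fx eqxx.
    * exact: f_inj.
  + move=> x /V'[->|->|[x1 x2 xV]]; rewrite ?g1 ?g2 ?gf // !inE.
    * by rewrite eqxx !orbT.
    * by rewrite [X in X == [set u1; u2]]setUC eqxx !orbT.
    * by rewrite f_edge.
- have u1B : u1 \notin black H.
    by apply: contra u1V; rewrite !inE => ->; rewrite orbT.
  set H' := ColoredGraph _ _ _ _.
  have V' x : x \in vertices H' :\: (u1 |: D) -> x \in vertices H :\: D.
    by rewrite /vertices !inE; case: (x == u1).
  (* The new black vertex joins the exceptional set, so [f] need not change. The set grows by at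
     most one, the black set by exactly one. *)
  exists (u1 |: D), f; split=> /=.
  + by rewrite !cardsU1 u1B -addnA leq_add ?leq_b1.
  + by move=> x y /V' xV /V'; apply: f_inj.
  + by move=> x /V' /f_edge fx; rewrite !inE fx orbT.
Qed.

End Procedure.

Theorem theorem4p14 (T : finType) (e : rel T)
    (e_sym : symmetric e) (e_irr : irreflexive e)
    (e_conn : connected e) (e_unicyclic : unicyclic e)
    (e_nonKE : ~~ konig_egervary e)
    (H : colored_graph T) (H_produces : produces H e) :
  critical e (black H).
Proof.
have [P VT E] := H_produces.
have eE x y : e x y = ([set x; y] \in edge_set H) by rewrite E edgesE.
have [D [f [cD f_inj f_edge]]] := procedure_defect P.
have VD : vertices H :\: D = ~: D by rewrite VT setTD.
rewrite VD in f_inj f_edge.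
have NB : #|neighborhood e (black H)| <= #|red H|.
  apply/subset_leq_card/subsetP => y; rewrite inE => /existsP[x /andP[xB]].
  by rewrite eE; apply: procedure_black_neighbor_red.
(* The chain is [difference e A <= #|D| <= #|black H| - #|red H| <= difference e (black H)]; the
   last inequality is [NB]. *)
have le_black A : (difference e A <= difference e (black H))%R.
  apply: (@Order.POrderTheory.le_trans _ _ #|D|%:Z%R).
    by apply: difference_le_defect f_inj _ => x /f_edge; rewrite eE.
  rewrite /difference Num.Theory.lerBrDr -PoszD lez_nat.
  by rewrite (leq_trans _ cD) // leq_add2l.
rewrite /critical /critical_difference Order.POrderTheory.eq_le.
(* For the upper bound, the default value [difference set0] of the maximum is also covered by
   [le_black]. *)
apply/andP; split; first exact: Order.TotalTheory.le_bigmax.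
exact: Order.POrderTheory.bigmax_le.
Qed.
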